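(* Every P-domain is perinormal.
   Context: All rings are commutative unitary integral domains. An overring of a domain $A$ is a ring $B$ between $A$ and the quotient field of $A$. An overring $B$ of $A$ is a going down overring if going down holds for $A\subseteq B$, that is, for each $Q\in\mathrm{Spec}(B)$ the induced map $\mathrm{Spec}(B_Q)\to\mathrm{Spec}(A_{Q\cap A})$ is surjective. $A$ is perinormal if every going down overring of $A$ is flat as an $A$-module. $A$ is a P-domain if $A_P$ is a valuation domain (fields count as valuation domains) for every prime ideal $P$ of $A$ which is minimal over an ideal of the form $Aa:b=\{x\in A\mid xb\in Aa\}$ with $a,b\in A$. *)

(* Defs.v *)
From HB Require Import structures.
From mathcomp Require Import all_boot all_algebra.
From mathcomp Require Import generic_quotient ring_quotient fraction.
From mathcomp Require Import boolp.

Set Implicit Arguments.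
Unset Strict Implicit.
Unset Printing Implicit Defensive.

Import GRing.Theory.
Local Open Scope ring_scope.
Local Open Scope quotient_scope.

Section Tensor.
Variables (R : comNzRingType) (M N : lmodType R).

(* The list [:: (m1, n1); ...; (mk, nk)] stands for the formal sum
   m1 (x) n1 + ... + mk (x) nk, and tensor_eqv is equality of such sums in
   M (x) N. Opposites need no constructor: (- m, n) is opposite to (m, n) by
   tensor_addl and tensor_zero. *)
Inductive tensor_eqv : seq (M * N) -> seq (M * N) -> Prop :=
| tensor_refl s : tensor_eqv s s
| tensor_sym s t : tensor_eqv s t -> tensor_eqv t s
| tensor_trans s t u : tensor_eqv s t -> tensor_eqv t u -> tensor_eqv s u
| tensor_perm s t : perm_eq s t -> tensor_eqv s t
| tensor_cat s t u : tensor_eqv s t -> tensor_eqv (s ++ u) (t ++ u)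
| tensor_zero n : tensor_eqv [:: (0, n)] [::]
| tensor_addl m m' n : tensor_eqv [:: (m + m', n)] [:: (m, n); (m', n)]
| tensor_addr m n n' : tensor_eqv [:: (m, n + n')] [:: (m, n); (m, n')]
| tensor_scale a m n : tensor_eqv [:: (a *: m, n)] [:: (m, a *: n)].

Definition tensor_rel : rel (seq (M * N)) := fun s t => `[< tensor_eqv s t >].

Lemma tensor_rel_refl : reflexive tensor_rel.
Proof. by move=> s; apply/asboolP; exact: tensor_refl. Qed.

Lemma tensor_rel_sym : symmetric tensor_rel.
Proof. by move=> s t; apply/asboolP/asboolP; exact: tensor_sym. Qed.

Lemma tensor_rel_trans : transitive tensor_rel.
Proof.
move=> t s u /asboolP st /asboolP tu; apply/asboolP.
exact: tensor_trans st tu.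
Qed.

Canonical tensor_equiv :=
  EquivRel tensor_rel tensor_rel_refl tensor_rel_sym tensor_rel_trans.

Definition tensor := {eq_quot tensor_equiv}.

Lemma tensor_piP (s t : seq (M * N)) :
  \pi_tensor s = \pi_tensor t <-> tensor_eqv s t.
Proof.
by split=> [/eqmodP/asboolP | st]; last by apply/eqmodP/asboolP.
Qed.

End Tensor.

Section TensorMap.
Variables (R : comNzRingType) (M N N' : lmodType R) (f : {linear N -> N'}).

Definition tensor_seq_map (s : seq (M * N)) : seq (M * N') :=
  [seq (x.1, f x.2) | x <- s].

Definition tensor_map (x : tensor M N) : tensor M N' :=
  \pi_(tensor M N') (tensor_seq_map (repr x)).

Lemma tensor_seq_map_eqv s t :
  tensor_eqv s t -> tensor_eqv (tensor_seq_map s) (tensor_seq_map t).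
Proof.
elim=> {s t} [s|s t _|s t u _ + _|s t st|s t u _|n|m m' n|m n n'|a m n].
- exact: tensor_refl.
- exact: tensor_sym.
- exact: tensor_trans.
- by apply: tensor_perm; exact: perm_map.
- by rewrite /tensor_seq_map !map_cat; exact: tensor_cat.
- exact: tensor_zero.
- exact: tensor_addl.
- by rewrite /tensor_seq_map /= linearD; exact: tensor_addr.
- by rewrite /tensor_seq_map /= linearZ; exact: tensor_scale.
Qed.

Lemma tensor_mapE (s : seq (M * N)) :
  tensor_map (\pi_(tensor M N) s) = \pi_(tensor M N') (tensor_seq_map s).
Proof.
apply/tensor_piP/tensor_seq_map_eqv/tensor_piP; exact: reprK.
Qed.

End TensorMap.

Definition flat (R : comNzRingType) (M : lmodType R) : Prop :=
  forall (N N' : lmodType R) (f : {linear N -> N'}),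
    injective f -> injective (@tensor_map R M N N' f).

Section Contraction.
Variables (R S : comNzRingType) (f : {rmorphism R -> S}) (Q : prime_idealr S).

Definition contract_pred : {pred R} := [pred x | f x \in (Q : pred S)].

Lemma contract_idealr : idealr_closed contract_pred.
Proof.
split=> [||a x y]; rewrite !inE ?rmorph0 ?rmorph1 ?idealr0 ?idealr1 //.
by rewrite rmorphD rmorphM => Qx Qy; rewrite rpredD // idealMr.
Qed.

Lemma contract_prime : prime_idealr_closed contract_pred.
Proof. by move=> x y; rewrite !inE rmorphM prime_idealrM. Qed.

HB.instance Definition _ := isIdealr.Build R contract_pred contract_idealr.
HB.instance Definition _ :=
  isPrimeIdealrClosed.Build R contract_pred contract_prime.

(* The map Spec S -> Spec R induced by f. *)
Definition contract : prime_idealr R := contract_pred.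

End Contraction.

Record overring (A : idomainType) := Overring {
  overring_pred :> {pred {fraction A}};
  overring_subring : subring_closed overring_pred;
  overring_base : forall a : A, tofrac a \in overring_pred }.

Section OverringType.
Variables (A : idomainType) (B : overring A).

HB.instance Definition _ :=
  GRing.isSubringClosed.Build {fraction A} (overring_pred B)
    (overring_subring B).

Record overring_type := OverringElt {
  ovval : {fraction A}; ovvalP : ovval \in overring_pred B }.

HB.instance Definition _ := [isSub for ovval].
HB.instance Definition _ := [Choice of overring_type by <:].
HB.instance Definition _ :=
  [SubChoice_isSubComNzRing of overring_type by <:].

Definition overring_scale (a : A) (x : overring_type) : overring_type :=
  OverringElt (overring_base B a) * x.

Lemma overring_scaleA a b x :
  overring_scale a (overring_scale b x) = overring_scale (a * b) x.
Proof. by apply: val_inj; rewrite /= tofracM mulrA. Qed.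

Lemma overring_scale1 : left_id 1 overring_scale.
Proof. by move=> x; apply: val_inj; rewrite /= tofrac1 mul1r. Qed.

Lemma overring_scaleDr : right_distributive overring_scale +%R.
Proof. by move=> a x y; rewrite /overring_scale mulrDr. Qed.

Lemma overring_scaleDl x : {morph overring_scale^~ x : a b / a + b}.
Proof. by move=> a b; apply: val_inj; rewrite /= tofracD mulrDl. Qed.

HB.instance Definition _ :=
  GRing.Zmodule_isLmodule.Build A overring_type
    overring_scaleA overring_scale1 overring_scaleDr overring_scaleDl.

End OverringType.

Coercion overring_type : overring >-> Sortclass.

Section Inclusions.
Variable A : idomainType.

Definition base_incl (B : overring A) (a : A) : B :=
  OverringElt (overring_base B a).

Lemma base_incl_zmod B : zmod_morphism (base_incl B).
Proof. by move=> a b; apply: val_inj; rewrite /= tofracB. Qed.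

Lemma base_incl_monoid B : monoid_morphism (base_incl B).
Proof.
by split=> [|a b]; apply: val_inj; rewrite /= (tofrac1, tofracM).
Qed.

HB.instance Definition _ (B : overring A) :=
  GRing.isZmodMorphism.Build A B (base_incl B) (base_incl_zmod B).
HB.instance Definition _ (B : overring A) :=
  GRing.isMonoidMorphism.Build A B (base_incl B) (base_incl_monoid B).

Variables (B C : overring A) (sBC : {subset B <= C}).

Definition overring_incl (x : B) : C := OverringElt (sBC (ovvalP x)).

Lemma overring_incl_zmod : zmod_morphism overring_incl.
Proof. by move=> x y; apply: val_inj. Qed.

Lemma overring_incl_monoid : monoid_morphism overring_incl.
Proof. by split=> [|x y]; apply: val_inj. Qed.

HB.instance Definition _ :=
  GRing.isZmodMorphism.Build B C overring_incl overring_incl_zmod.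
HB.instance Definition _ :=
  GRing.isMonoidMorphism.Build B C overring_incl overring_incl_monoid.

End Inclusions.

Section Localization.
Variables (A : idomainType) (R : comNzRingType).
Variable i : {rmorphism R -> {fraction A}}.
Hypotheses (i_inj : injective i) (iA : forall a : A, exists r, i r = tofrac a).
Variable Q : prime_idealr R.

(* R_Q, for a ring R embedded by i between A and its quotient field. *)
Definition local_pred : {pred {fraction A}} :=
  [pred x | `[< exists r s : R, s \notin (Q : pred R) /\ x = i r / i s >]].

Lemma local_den s : s \notin (Q : pred R) -> i s != 0.
Proof.
apply: contra => /eqP; rewrite -(rmorph0 i) => /i_inj ->; exact: idealr0.
Qed.

Lemma local_subring : subring_closed local_pred.
Proof.
have Q1 : (1 : R) \notin (Q : pred R) by rewrite idealr1.
split=> [|x y|x y].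
- by apply/asboolP; exists 1, 1; rewrite rmorph1 divr1.
- move=> /asboolP[r [s [Qs ->]]] /asboolP[r' [s' [Qs' ->]]]; apply/asboolP.
  exists (r * s' - r' * s), (s * s'); rewrite prime_idealrM negb_or Qs Qs'.
  by rewrite -mulNr addf_div ?local_den // mulNr rmorphB !rmorphM.
- move=> /asboolP[r [s [Qs ->]]] /asboolP[r' [s' [Qs' ->]]]; apply/asboolP.
  exists (r * r'), (s * s'); rewrite prime_idealrM negb_or Qs Qs'.
  by rewrite !rmorphM mulf_div.
Qed.

Lemma local_base a : tofrac a \in local_pred.
Proof.
have [r ir] := iA a; apply/asboolP; exists r, 1.
by rewrite idealr1 rmorph1 divr1 ir.
Qed.

Definition local_ring : overring A := Overring local_subring local_base.

End Localization.

Section LocalizationInstances.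
Variable A : idomainType.

Lemma tofrac_inj : injective (@tofrac A).
Proof. by move=> x y /eqP; rewrite tofrac_eq => /eqP. Qed.

Lemma tofrac_base (a : A) : exists r : A, tofrac r = tofrac a.
Proof. by exists a. Qed.

Definition base_local (P : prime_idealr A) : overring A :=
  local_ring tofrac_inj tofrac_base P.

Variable B : overring A.

Lemma overring_val_base (a : A) : exists b : B, \val b = tofrac a.
Proof. by exists (base_incl B a). Qed.

Definition overring_local (Q : prime_idealr B) : overring A :=
  local_ring (val_inj : injective (\val : B -> {fraction A}))
    overring_val_base Q.

Lemma base_local_sub (Q : prime_idealr B) :
  {subset base_local (contract (base_incl B) Q) <= overring_local Q}.
Proof.
move=> x /asboolP[r [s [Qs ->]]]; apply/asboolP.
by exists (base_incl B r), (base_incl B s).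
Qed.

Definition local_incl (Q : prime_idealr B) :
    base_local (contract (base_incl B) Q) -> overring_local Q :=
  overring_incl (@base_local_sub Q).

Arguments local_incl : clear implicits.

HB.instance Definition _ (Q : prime_idealr B) :=
  GRing.RMorphism.on (local_incl Q).

End LocalizationInstances.

Arguments local_incl {A B} Q x.

Definition going_down (A : idomainType) (B : overring A) : Prop :=
  forall (Q : prime_idealr B)
    (P : prime_idealr (base_local (contract (base_incl B) Q))),
  exists Q' : prime_idealr (overring_local Q), contract (local_incl Q) Q' =i P.

Definition perinormal (A : idomainType) : Prop :=
  forall B : overring A, going_down B -> flat (B : lmodType A).

(* An overring of A has the same quotient field as A. *)
Definition valuation_overring (A : idomainType) (V : overring A) : Prop :=
  forall x : {fraction A}, x != 0 -> (x \in V) || (x^-1 \in V).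

Definition conductor (A : idomainType) (a b : A) : {pred A} :=
  [pred x | `[< exists y : A, x * b = y * a >]].

Definition minimal_prime_over (R : comNzRingType) (I : {pred R})
    (P : prime_idealr R) : Prop :=
  {subset I <= P} /\
  forall P' : prime_idealr R,
    {subset I <= P'} -> {subset P' <= P} -> {subset P <= P'}.

Definition P_domain (A : idomainType) : Prop :=
  forall P : prime_idealr A,
    (exists a b : A, minimal_prime_over (conductor a b) P) ->
    valuation_overring (base_local P).

(* Main.v *)
(** Let [B] be a going down overring of a P-domain [A], [Q] a prime of [B] and
    [P] its contraction. If [x = n / d] in [B] had no denominator in [A] outside
    [P], the conductor [Ad : n] would lie in [P], hence in a prime [P'] of [A]
    inside [P] and minimal over it. Then [x] is not in the valuation ring
    [A_P'], so [x^-1 = r / s] with [r] in [P'] and [s] outside [P']. Going down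
    lifts [P'] to a prime of [B_Q], which contains [s = x r]: a contradiction.

    So for every [Q] each element of [B] has a denominator in [A] outside [Q].
    By induction on the generation of [tensor_eqv], if two formal sums are equal
    in [B (x) N'], then for each [Q] some [a] in [A] outside [Q] clears the
    denominators of both and gives them the same value in [N']. When the sums
    come from [B (x) N] along an injection [N -> N'], these values already agree
    in [N], so the ideal of those [c] in [B] that equalise the two sums in
    [B (x) N] lies in no prime ideal of [B], and it contains [1]. *)

Require Import Defs.
From HB Require Import structures.
From mathcomp Require Import all_boot all_algebra.
From mathcomp Require Import generic_quotient ring_quotient fraction.
From mathcomp Require Import boolp classical_sets.

Set Implicit Arguments.
Unset Strict Implicit.
Unset Printing Implicit Defensive.

Import GRing.Theory.
Local Open Scope ring_scope.

(** * Prime ideals from Zorn's lemma *)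

Lemma exists_prime_idealr (R : comNzRingType) (S : {pred R}) :
  idealr_closed S -> prime_idealr_closed S ->
  exists P : prime_idealr R, (P : pred R) =i S.
Proof.
move=> hI hP.
pose I := isIdealr.Build R S hI; pose P := isPrimeIdealrClosed.Build R S hP.
pose SP : prime_idealr R := HB.pack (S : R -> bool) I P.
by exists SP.
Qed.

Lemma idealr_closedMl (R : comNzRingType) (J : {pred R}) a x :
  idealr_closed J -> x \in J -> a * x \in J.
Proof. by case=> J0 _ JD Jx; rewrite -[a * x]addr0; apply: JD. Qed.

(** Zorn's lemma among the proper ideals containing [I] ([idealr_closed] already excludes 1) gives a
    maximal [M]. If [u] is not in [M], then [M + Ru] contains 1; multiplying by [v] puts [v] in [M]
    when [uv] is in [M]. *)
Lemma proper_ideal_sub_prime (R : comNzRingType) (I : {pred R}) :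
  idealr_closed I -> exists P : prime_idealr R, {subset I <= (P : pred R)}.
Proof.
move=> hI.
pose T := {J : {pred R} | idealr_closed J /\ {subset I <= J}}.
pose le (s t : T) := `[< {subset sval s <= sval t} >].
pose t0 : T := exist _ I (conj hI (fun x Ix => Ix)).
have [|||[M [hM IM]] maxM] := @ZL_preorder T t0 le.
- by move=> t; apply/asboolP => x.
- move=> r s t /asboolP rs /asboolP st; apply/asboolP => x /rs; exact: st.
(* The empty chain is bounded by [I] itself, a nonempty one by its union. *)
- move=> C totC; have [[J0 CJ0]|C0] := pselect (exists J, C J); last first.
    by exists t0 => s Cs; case: C0; exists s.
  pose U : {pred R} := [pred x | `[< exists2 J : T, C J & x \in sval J >]].
  have UI : idealr_closed U.
    split.
    + by apply/asboolP; exists J0 => //; case: (svalP J0) => -[].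
    + by apply/asboolP => -[J _]; apply/negP; case: (svalP J) => -[].
    + move=> a x y /asboolP[J CJ Jx] /asboolP[K CK Ky]; apply/asboolP.
      have [/asboolP JK|/asboolP KJ] := totC J K CJ CK.
        exists K => //; case: (svalP K) => -[_ _ KD] _.
        by apply: KD => //; apply: JK.
      exists J => //; case: (svalP J) => -[_ _ JD] _.
      by apply: JD => //; apply: KJ.
  have IU : {subset I <= U}.
    move=> x Ix; apply/asboolP; exists J0 => //.
    by case: (svalP J0) => _; apply.
  exists (exist _ U (conj UI IU)) => J CJ; apply/asboolP => x Jx.
  by apply/asboolP; exists J.
have [M0 M1 MD] := hM.
have Mprime : prime_idealr_closed M.
  move=> u v Muv; apply/orP; have [|Mu] := boolP (u \in M); first by left.
  pose K : {pred R} :=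
    [pred x | `[< exists2 m, m \in M & exists r, x = m + r * u >]].
  have MK : {subset M <= K}.
    move=> x Mx; apply/asboolP; exists x => //.
    by exists 0; rewrite mul0r addr0.
  have Ku : u \in K.
    by apply/asboolP; exists 0 => //; exists 1; rewrite mul1r add0r.
  have [/asboolP[m Mm [r e1]]|K1] := boolP (1 \in K).
    right; rewrite -[v]mul1r e1 mulrDl -mulrA [m * v]mulrC.
    by apply: MD => //; exact: idealr_closedMl.
  have hK : idealr_closed K.
    split=> //; first exact: MK.
    move=> a x y /asboolP[m Mm [r ->]] /asboolP[n Mn [s ->]]; apply/asboolP.
    exists (a * m + n); first exact: MD.
    by exists (a * r + s); rewrite mulrDr mulrA mulrDl addrACA.
  have IK : {subset I <= K} by move=> x /IM; exact: MK.
  have /asboolP/(_ u Ku) : le (exist _ K (conj hK IK)) (exist _ M (conj hM IM)).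
    by apply: maxM; apply/asboolP.
  by rewrite /= (negPf Mu).
have [P PM] := exists_prime_idealr hM Mprime.
by exists P => x /IM; rewrite PM.
Qed.

(** Zorn's lemma for reverse inclusion: the intersection of a nonempty chain of primes between [I]
    and [P] is again such a prime. *)
Lemma exists_minimal_prime (R : comNzRingType) (I : {pred R})
    (P : prime_idealr R) : {subset I <= (P : pred R)} ->
  exists2 P' : prime_idealr R, {subset (P' : pred R) <= (P : pred R)} &
    minimal_prime_over I P'.
Proof.
move=> IP.
pose T := {Q : prime_idealr R |
  {subset I <= (Q : pred R)} /\ {subset (Q : pred R) <= (P : pred R)}}.
pose mem_T x (t : T) := x \in (sval t : pred R).
pose le (s t : T) := `[< forall x, mem_T x t -> mem_T x s >].
pose t0 : T := exist _ P (conj IP (fun x Px => Px)).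
have [|||[M [IM MP]] minM] := @ZL_preorder T t0 le.
- by move=> t; apply/asboolP => x.
- move=> r s t /asboolP rs /asboolP st; apply/asboolP => x /st; exact: rs.
- move=> C totC; have [[J0 CJ0]|C0] := pselect (exists J, C J); last first.
    by exists t0 => s Cs; case: C0; exists s.
  pose U : {pred R} := [pred x | `[< forall J : T, C J -> mem_T x J >]].
  have UI : idealr_closed U.
    split.
    + by apply/asboolP => J _; exact: idealr0.
    + by apply/asboolP => /(_ J0 CJ0); rewrite /mem_T idealr1.
    + move=> a x y /asboolP Ux /asboolP Uy; apply/asboolP => J CJ.
      by apply: rpredD; [apply: idealMr; exact: Ux | exact: Uy].
  have Uprime : prime_idealr_closed U.
    move=> u v /asboolP Uuv; apply/orP.
    have [|/asboolP/existsNP[J /not_implyP[CJ Ju]]] := boolP (u \in U).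
      by left.
    right; apply/asboolP => K CK; have := Uuv _ CJ; have := Uuv _ CK.
    rewrite /mem_T !prime_idealrM.
    case/orP=> // Ku /orP[//|Jv].
    (* If [K] were inside [J], then [u] would lie in [J]; so [J] is inside [K], and [v] lies in
       [K]. *)
    have [/asboolP JK|/asboolP KJ] := totC J K CJ CK.
      by case: Ju; exact: JK.
    exact: KJ.
  have [Q QU] := exists_prime_idealr UI Uprime.
  have IQ : {subset I <= (Q : pred R)}.
    move=> x Ix; rewrite QU; apply/asboolP => J _.
    by case: (svalP J) => + _; apply.
  have QP : {subset (Q : pred R) <= (P : pred R)}.
    move=> x; rewrite QU => /asboolP/(_ J0 CJ0).
    by case: (svalP J0) => _; apply.
  exists (exist _ Q (conj IQ QP)) => J CJ; apply/asboolP => x.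
  by rewrite /mem_T /= QU => /asboolP; apply.
exists M => //; split=> // Q IQ QM.
have QP : {subset (Q : pred R) <= (P : pred R)} by move=> x /QM; exact: MP.
have /asboolP : le (exist _ Q (conj IQ QP)) (exist _ M (conj IM MP)).
  by apply: minM; apply/asboolP.
by [].
Qed.

(** * The action of [B] on formal sums *)

Section TensorScale.
Variables (A : idomainType) (B : overring A) (N : lmodType A).
Implicit Types (s t u : seq (B * N)) (b c : B).

Lemma tensor_cat2 s s' t t' :
  tensor_eqv s s' -> tensor_eqv t t' -> tensor_eqv (s ++ t) (s' ++ t').
Proof.
move=> ss' tt'; apply: tensor_trans (tensor_cat _ ss') _.
apply: (@tensor_trans _ _ _ _ (t ++ s')).
  exact/tensor_perm/permEl/perm_catC.
apply: tensor_trans (tensor_cat _ tt') _; exact/tensor_perm/permEl/perm_catC.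
Qed.

(** The [B]-module structure of B (x) N on representatives; [tensor_eqv] itself only knows scalars
    in [A]. *)
Definition tensor_mul c s : seq (B * N) := [seq (c * x.1, x.2) | x <- s].

Lemma tensor_mul_eqv c s t :
  tensor_eqv s t -> tensor_eqv (tensor_mul c s) (tensor_mul c t).
Proof.
elim=> {s t} [s|s t _|s t u _ + _|s t st|s t u _|n|m m' n|m n n'|a m n].
- exact: tensor_refl.
- exact: tensor_sym.
- exact: tensor_trans.
- by apply: tensor_perm; exact: perm_map.
- by rewrite /tensor_mul !map_cat; exact: tensor_cat.
- by rewrite /= mulr0; exact: tensor_zero.
- by rewrite /= mulrDr; exact: tensor_addl.
- exact: tensor_addr.
- have -> : tensor_mul c [:: (a *: m, n)] = [:: (a *: (c * m), n)].
    by congr [:: (_, _)]; exact: mulrCA.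
  exact: tensor_scale.
Qed.

Lemma tensor_mul_comp b c s :
  tensor_mul b (tensor_mul c s) = tensor_mul (b * c) s.
Proof.
by rewrite /tensor_mul -map_comp; apply: eq_map => x /=; rewrite mulrA.
Qed.

Lemma tensor_mul1 s : tensor_mul 1 s = s.
Proof. by rewrite -[RHS]map_id; apply: eq_map => -[b n] /=; rewrite mul1r. Qed.

Lemma tensor_mul0 s : tensor_eqv (tensor_mul 0 s) [::].
Proof.
elim: s => [|x s IHs] /=; first exact: tensor_refl.
rewrite mul0r -cat1s; exact: (tensor_cat2 (tensor_zero _ _) IHs).
Qed.

Lemma tensor_mulD b c s :
  tensor_eqv (tensor_mul (b + c) s) (tensor_mul b s ++ tensor_mul c s).
Proof.
elim: s => [|x s IHs]; first exact: tensor_refl.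
rewrite /= mulrDl -cat1s.
apply: tensor_trans (tensor_cat2 (tensor_addl _ _ _) IHs) _.
apply: tensor_perm => /=; rewrite perm_cons.
by rewrite -[_ :: _ ++ _]cat1s -[_ :: tensor_mul c s]cat1s perm_catCA.
Qed.

(** This is the annihilator in [B] of the difference of the two tensors; it is proper because 1
    leaves both sums unchanged. *)
Lemma tensor_mul_idealr s t : ~ tensor_eqv s t ->
  idealr_closed
    [pred c : B | `[< tensor_eqv (tensor_mul c s) (tensor_mul c t) >]].
Proof.
move=> st; split.
- apply/asboolP.
  exact: tensor_trans (tensor_mul0 s) (tensor_sym (tensor_mul0 t)).
- by rewrite inE !tensor_mul1; apply/asboolP.
move=> a b c /asboolP Eb /asboolP Ec; apply/asboolP.
apply: tensor_trans (tensor_mulD _ _ s) _.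
apply: tensor_trans (tensor_sym (tensor_mulD _ _ t)).
by rewrite -!tensor_mul_comp; apply: tensor_cat2 => //; exact: tensor_mul_eqv.
Qed.

End TensorScale.

(** * Clearing denominators in formal sums *)

Section Denominators.
Variables (A : idomainType) (B : overring A).
Implicit Types (a c : A) (b : B).

Definition is_denom a b : bool := `[< exists c, a *: b = base_incl B c >].

(** The value is unique since [base_incl] is injective; 0 is the default when [a] is no denominator
    of [b]. *)
Definition numer a b : A := xget 0 [set c | a *: b = base_incl B c].

Lemma base_incl_inj : injective (base_incl B).
Proof. by move=> a c /(congr1 val) /=; exact: tofrac_inj. Qed.

Lemma base_incl_scale a b : a *: b = base_incl B a * b.
Proof. by []. Qed.

Lemma is_denomP a b c : a *: b = base_incl B c -> is_denom a b.
Proof. by move=> abc; apply/asboolP; exists c. Qed.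

Lemma numerP a b : is_denom a b -> a *: b = base_incl B (numer a b).
Proof.
by move=> /asboolP[c abc]; rewrite /numer; case: xgetP => [x _ //|/(_ c)].
Qed.

Lemma numerE a b c : a *: b = base_incl B c -> numer a b = c.
Proof.
by move=> abc; apply: base_incl_inj; rewrite -numerP ?(is_denomP abc).
Qed.

Lemma is_denomM r a b : is_denom a b -> is_denom (r * a) b.
Proof.
move=> /numerP ab; apply: (@is_denomP _ _ (r * numer a b)).
by rewrite rmorphM /= -scalerA ab.
Qed.

Lemma numerM r a b : is_denom a b -> numer (r * a) b = r * numer a b.
Proof.
by move=> ab; apply: numerE; rewrite rmorphM /= -scalerA (numerP ab).
Qed.

Variable N : lmodType A.
Implicit Types (s t u : seq (B * N)).

Definition clears a s : bool := all (fun x => is_denom a x.1) s.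

(** When [a] clears [s], this is [a] times the tensor, read in A (x) N = N. *)
Definition cleared a s : N := \sum_(x <- s) numer a x.1 *: x.2.

Lemma clearsM r a s : clears a s -> clears (r * a) s.
Proof. by apply: sub_all => x; exact: is_denomM. Qed.

Lemma clearedM r a s : clears a s -> cleared (r * a) s = r *: cleared a s.
Proof.
move=> /allP as_; rewrite scaler_sumr; apply: eq_big_seq => x /as_ ax.
by rewrite numerM // scalerA.
Qed.

Lemma cleared_cat a s t : cleared a (s ++ t) = cleared a s + cleared a t.
Proof. exact: big_cat. Qed.

Lemma cleared1 a b n : cleared a [:: (b, n)] = numer a b *: n.
Proof. exact: big_seq1. Qed.

(** Term by term, ab (x) n = 1 (x) (ab)n because ab lies in [A]; additivity on the right then
    collects the terms. *)
Lemma tensor_cleared a s : clears a s ->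
  tensor_eqv (tensor_mul (base_incl B a) s) [:: (1, cleared a s)].
Proof.
elim: s => [|[b n] s IHs] /=.
  (* Writing the right-hand 0 as [0 *: 0] moves a zero to the left factor, where [tensor_zero]
     applies. *)
  rewrite /cleared big_nil => _; apply: tensor_sym.
  rewrite -(scale0r (0 : N)).
  apply: tensor_trans (tensor_sym (tensor_scale _ _ _)) _.
  rewrite scale0r; exact: tensor_zero.
case/andP => ab /IHs{}IHs; rewrite -cat1s -[(b, n) :: s]cat1s.
rewrite cleared_cat cleared1.
apply: tensor_trans (tensor_sym (tensor_addr _ _ _)); rewrite -[[:: _; _]]cat1s.
apply: (tensor_cat2 _ IHs); rewrite -base_incl_scale numerP //.
apply: tensor_trans (tensor_scale _ _ _).
by rewrite base_incl_scale mulr1; exact: tensor_refl.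
Qed.

Definition agree a s t : bool :=
  [&& clears a s, clears a t & cleared a s == cleared a t].

Lemma agreeM r a s t : agree a s t -> agree (r * a) s t.
Proof.
case/and3P=> as_ at_ /eqP e; apply/and3P; split; try exact: clearsM.
by rewrite !clearedM // e.
Qed.

Lemma tensor_agree a s t : agree a s t ->
  tensor_eqv (tensor_mul (base_incl B a) s) (tensor_mul (base_incl B a) t).
Proof.
case/and3P=> as_ at_ /eqP e; apply: tensor_trans (tensor_cleared as_) _.
by rewrite e; exact: tensor_sym (tensor_cleared at_).
Qed.

Variable Q : prime_idealr B.
Local Notation "a # Q" := (base_incl B a \notin (Q : pred B)) (at level 70).
Hypothesis denQ : forall b, exists2 a, a # Q & is_denom a b.

Lemma avoidM a c : a # Q -> c # Q -> a * c # Q.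
Proof. by move=> aQ cQ; rewrite rmorphM /= prime_idealrM negb_or aQ. Qed.

Lemma exists_clears s : exists2 a, a # Q & clears a s.
Proof.
elim: s => [|x s [a aQ as_]]; first by exists 1; rewrite // rmorph1 idealr1.
have [c cQ cx] := denQ x.1.
by exists (c * a); rewrite ?avoidM //= mulrC is_denomM //= mulrC clearsM.
Qed.

(** Different multipliers are reconciled by passing to their product, which avoids [Q] because [Q]
    is prime. *)
Lemma exists_agree s t : tensor_eqv s t -> exists2 a, a # Q & agree a s t.
Proof.
elim=> {s t} [s|s t _|s t u _ [a aQ ast] _ [c cQ ctu]|s t st|s t u _ [a aQ ast]
             |n|m m' n|m n n'|r m n].
- have [a aQ as_] := exists_clears s; exists a => //.
  by rewrite /agree as_ eqxx.
- case=> a aQ /and3P[as_ at_ /eqP e].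
  by exists a; rewrite // /agree as_ at_ e eqxx.
- exists (c * a); first exact: avoidM.
  have /and3P[h1 _ /eqP e1] := agreeM c ast.
  have /and3P[_ h2 /eqP e2] := agreeM a ctu; rewrite mulrC in h2 e2.
  by rewrite /agree h1 h2 e1 e2 /=.
- have [a aQ as_] := exists_clears s; exists a => //.
  rewrite /agree /clears -(perm_all _ st) [all _ s]as_ /cleared.
  by rewrite (perm_big _ st) eqxx.
- have [c cQ cu] := exists_clears u; exists (c * a); first exact: avoidM.
  have /and3P[h1 h2 /eqP e] := agreeM c ast.
  have h : clears (c * a) u by rewrite mulrC clearsM.
  rewrite /agree /clears !all_cat -!/(clears _ _) !cleared_cat.
  by rewrite e eqxx h1 h2 !andbT h.
- exists 1; first by rewrite rmorph1 idealr1.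
  have e0 : 1 *: (0 : B) = base_incl B 0 by rewrite scaler0 rmorph0.
  rewrite /agree /= (is_denomP e0) cleared1 (numerE e0) scale0r.
  by rewrite /cleared big_nil eqxx.
- have [a aQ /=/and3P[am am' _]] := exists_clears [:: (m, n); (m', n)].
  exists a => //.
  have e : a *: (m + m') = base_incl B (numer a m + numer a m').
    by rewrite scalerDr rmorphD /= !numerP.
  rewrite /agree /= (is_denomP e) am am' -[[:: _; _]]cat1s cleared_cat.
  by rewrite !cleared1 (numerE e) scalerDl eqxx.
- have [a aQ am] := denQ m; exists a => //.
  by rewrite /agree /= am -[[:: _; _]]cat1s cleared_cat !cleared1 scalerDr eqxx.
- have [a aQ am] := denQ m; exists a => //.
  have e : a *: (r *: m) = base_incl B (r * numer a m).
    by rewrite scalerA mulrC -scalerA rmorphM /= -numerP.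
  by rewrite /agree /= (is_denomP e) am !cleared1 (numerE e) scalerA mulrC eqxx.
Qed.

End Denominators.

(** * Flatness from denominators outside each prime *)

Lemma flat_of_denominators (A : idomainType) (B : overring A) :
  (forall (Q : prime_idealr B) (b : B), exists2 a : A,
     base_incl B a \notin (Q : pred B) & is_denom a b) ->
  flat (B : lmodType A).
Proof.
move=> den N N' f f_inj x y; rewrite -[x]reprK -[y]reprK.
move: (repr x) (repr y) => s t; rewrite !tensor_mapE => /tensor_piP fst.
apply/tensor_piP; apply: contrapT => /tensor_mul_idealr.
case/proper_ideal_sub_prime => Q JQ.
have [a /negP aQ /and3P[as_ at_ /eqP e]] := exists_agree (den Q) fst.
have cl u : clears a (tensor_seq_map f u) = clears a u by rewrite /clears all_map.
have cld u : cleared a (tensor_seq_map f u) = f (cleared a u).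
  rewrite /cleared big_map linear_sum; apply: eq_bigr => z _ /=.
  by rewrite linearZ.
(* Clearing commutes with the injective [f], so [a] equalises [s] and [t] already in B (x) N and
   thus lies in [Q]. *)
case: aQ; apply: JQ; apply/asboolP; apply: tensor_agree.
by rewrite /agree -!cl as_ at_ /=; apply/eqP/f_inj; rewrite -!cld.
Qed.

(** * Denominators from going down *)

Lemma base_localP (A : idomainType) (P : prime_idealr A) (x : {fraction A}) :
  reflect (exists r s : A, s \notin (P : pred A) /\ x = tofrac r / tofrac s)
    (x \in base_local P).
Proof. exact: asboolP. Qed.

(** [L] is the extension of [P'] to A_P. Any fraction may be used to test membership: if r/s = r'/s'
    with r' in [P'], then rs' is in [P'], while s' is outside [P] and so outside [P']. *)
Lemma extended_prime (A : idomainType) (P P' : prime_idealr A) :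
  {subset (P' : pred A) <= (P : pred A)} ->
  exists L : prime_idealr (base_local P), forall (x : base_local P) (r s : A),
    s \notin (P : pred A) -> \val x = tofrac r / tofrac s ->
    (x \in (L : pred _)) = (r \in (P' : pred A)).
Proof.
move=> P'P.
have denP s : s \notin (P : pred A) -> tofrac s != 0.
  exact: local_den (@tofrac_inj A) P s.
pose L : {pred base_local P} :=
  [pred x | `[< exists2 r : A, r \in (P' : pred A) &
    exists2 s : A, s \notin (P : pred A) & \val x = tofrac r / tofrac s >]].
have memL (x : base_local P) r s : s \notin (P : pred A) ->
    \val x = tofrac r / tofrac s -> (x \in L) = (r \in (P' : pred A)).
  move=> Ps xrs; apply/asboolP/idP => [[r' P'r' [s' Ps' ]]|P'r]; last first.
    by exists r => //; exists s.
  rewrite xrs => /eqP; rewrite eqr_div ?denP // -!tofracM tofrac_eq => /eqP e.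
  have : r * s' \in (P' : pred A) by rewrite e mulrC idealMr.
  by rewrite prime_idealrM => /orP[//|/P'P]; rewrite (negPf Ps').
have fracP (x : base_local P) : exists r s : A,
    s \notin (P : pred A) /\ \val x = tofrac r / tofrac s.
  by case: x => x /= /base_localP.
have P1 : 1 \notin (P : pred A) by rewrite idealr1.
have hL : idealr_closed L.
  split.
  - by rewrite (memL _ 0 1) ?idealr0 // /= tofrac0 mul0r.
  - by rewrite (memL _ 1 1) ?idealr1 // /= tofrac1 divr1.
  move=> a x y; have [ra [sa [Psa ea]]] := fracP a.
  have [r [s [Ps ex]]] := fracP x; have [r' [s' [Ps' ey]]] := fracP y.
  rewrite (memL _ _ _ Ps ex) (memL _ _ _ Ps' ey) => P'r P'r'.
  rewrite (memL _ (ra * r * s' + r' * (sa * s)) (sa * s * s')).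
  - apply: rpredD; last by rewrite mulrC idealMr.
    by rewrite mulrC idealMr // idealMr.
  - by rewrite !prime_idealrM !negb_or Psa Ps.
  rewrite /= ea ex ey mulf_div addf_div ?mulf_neq0 ?denP //.
  by rewrite tofracD !tofracM.
have pL : prime_idealr_closed L.
  move=> x y.
  have [r [s [Ps ex]]] := fracP x; have [r' [s' [Ps' ey]]] := fracP y.
  rewrite (memL _ _ _ Ps ex) (memL _ _ _ Ps' ey) (memL _ (r * r') (s * s')).
  - by rewrite prime_idealrM.
  - by rewrite prime_idealrM negb_or Ps.
  by rewrite /= ex ey mulf_div !tofracM.
have [Lp LpL] := exists_prime_idealr hL pL.
by exists Lp => x r s Ps xrs; rewrite LpL (memL _ r s).
Qed.

Lemma exists_fraction (A : idomainType) (x : {fraction A}) :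
  exists2 a : A, a != 0 & exists b, x = tofrac b / tofrac a.
Proof.
elim/quotW: x => -[[n d] /= d0]; exists d => //; exists n.
apply: (canRL (mulfK _)); first by rewrite tofrac_eq0.
rewrite !piE; apply/eqP; rewrite piE.
rewrite FracField.equivfE /FracField.mulf !numden_Ratio ?mulf_neq0 ?oner_eq0 //=.
by rewrite !mulr1 mulrC.
Qed.

Lemma going_down_denominator (A : idomainType) (B : overring A)
    (Q : prime_idealr B) (b : B) :
  P_domain A -> going_down B ->
  exists2 a : A, base_incl B a \notin (Q : pred B) & is_denom a b.
Proof.
move=> hA gd; apply: contrapT => noden.
have [d d0 [n bE]] := exists_fraction (\val b).
pose P : prime_idealr A := contract (base_incl B) Q.
have d0' : tofrac d != 0 by rewrite tofrac_eq0.
(* If [a n = y d], then [a b = y], so [a] is a denominator of [b] and must lie in [P]. *)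
have IP : {subset conductor d n <= (P : pred A)}.
  move=> a /asboolP[y e]; apply: contrapT => /negP aP; apply: noden.
  exists a => //; apply: (@is_denomP _ _ _ _ y); apply: val_inj.
  by rewrite /= bE mulrA -tofracM e tofracM mulfK.
have [P' P'P minP'] := exists_minimal_prime IP.
(* If [b = r / s] with [s] outside [P'], then [s n = r d] puts [s] in the conductor, which lies in
   [P']. *)
have bP' : \val b \notin base_local P'.
  apply/base_localP => -[r [s [P's brs]]]; apply: (negP P's); apply: minP'.1.
  apply/asboolP; exists r; apply/eqP; rewrite -tofrac_eq !tofracM.
  have s0 : tofrac s != 0.
    by rewrite tofrac_eq0; apply/eqP => s0; move: P's; rewrite s0 idealr0.
  by rewrite mulrC -eqr_div // -bE brs.
have b0 : \val b != 0.
  by apply: contra bP' => /eqP ->; rewrite -tofrac0; exact: overring_base.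
have := hA P' (ex_intro _ d (ex_intro _ n minP')) _ b0.
rewrite (negPf bP') orFb => /base_localP[r [s [P's ers]]].
have r0 : tofrac r != 0.
  by apply/eqP => r0; move: b0; rewrite -invr_eq0 ers r0 mul0r eqxx.
(* Otherwise [b = s / r] would lie in the localization at [P']. *)
have P'r : r \in (P' : pred A).
  apply: contraT => P'r; case/negP: bP'.
  apply/base_localP; exists s, r; split=> //.
  by rewrite -[LHS]invrK ers invf_div.
have [L memL] := extended_prime P'P.
have [Q' Q'L] := gd Q L.
have Q'P' c : (local_incl Q (base_incl (base_local P) c) \in (Q' : pred _)) =
    (c \in (P' : pred A)).
  have := Q'L (base_incl (base_local P) c).
  rewrite inE => ->; rewrite (memL _ c 1) ?idealr1 //= tofrac1 divr1 //.
have bQ : \val b \in overring_local Q.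
  by apply/asboolP; exists b, 1; rewrite idealr1 rmorph1 divr1.
(* In B_Q, [s = b r] with [r] in [Q']; hence [s] is in [Q'], and so in [P']. *)
have sE : local_incl Q (base_incl (base_local P) s) =
    OverringElt bQ * local_incl Q (base_incl (base_local P) r).
  apply: val_inj; change (tofrac s = \val b * tofrac r).
  by rewrite -[\val b]invrK ers invf_div divfK.
by case/negP: P's; rewrite -Q'P' sE idealMr // Q'P'.
Qed.

Theorem theorem2 (A : idomainType) (hA : P_domain A) : perinormal A.
Proof.
move=> B gd; apply: flat_of_denominators => Q b.
exact: going_down_denominator.
Qed.
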